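(* Let $(X,A)$ be a full Hilbert bimodule and let $(Y,B)$ be an extension of $(X,A)$, with associated morphism $(\psi_X,\psi_A):(X,A)\to(Y,B)$. Then there is a unique morphism of Hilbert bimodules $$(\lambda_Y,\lambda_B):(Y,B)\to(M(X),M(A))$$ such that $(\lambda_Y,\lambda_B)\circ(\psi_X,\psi_A)=(\iota_X,\iota_A)$. Furthermore, $(\lambda_Y,\lambda_B)$ is injective if and only if the extension $(Y,B)$ is essential.
   Context: For a $C^*$-algebra $A$, a right Hilbert $A$-module is a Banach space $X$ with a non-degenerate right action of $A$ and an $A$-valued inner product $\langle\cdot,\cdot\rangle_X$ with $\langle \xi,\eta a\rangle_X=\langle\xi,\eta\rangle_X a$, $\langle\eta,\xi\rangle_X=\langle\xi,\eta\rangle_X^*$, $\langle\xi,\xi\rangle_X\ge 0$ and $\|\xi\|=\|\langle\xi,\xi\rangle_X\|^{1/2}$. A left Hilbert $A$-module is a Banach space with a non-degenerate left action of $A$ and an $A$-valued inner product ${}_X\langle\cdot,\cdot\rangle$ with ${}_X\langle a\xi,\eta\rangle=a\,{}_X\langle\xi,\eta\rangle$, ${}_X\langle\eta,\xi\rangle={}_X\langle\xi,\eta\rangle^*$, ${}_X\langle\xi,\xi\rangle\ge0$ and $\|\xi\|=\|{}_X\langle\xi,\xi\rangle\|^{1/2}$. The pair $(X,A)$ is a Hilbert bimodule if $X$ is simultaneously a left and a right Hilbert $A$-module and ${}_X\langle\xi,\eta\rangle\zeta=\xi\langle\eta,\zeta\rangle_X$ for all $\xi,\eta,\zeta\in X$.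 It is full if both ${}_X\langle X,X\rangle$ and $\langle X,X\rangle_X$ span dense subspaces of $A$ (i.e. $X$ is an imprimitivity bimodule). A morphism $(X,A)\to(Y,B)$ of Hilbert bimodules is a pair $(\psi_X,\psi_A)$ with $\psi_X:X\to Y$ linear and $\psi_A:A\to B$ a $*$-homomorphism such that $\psi_X(\xi a)=\psi_X(\xi)\psi_A(a)$, $\psi_X(a\xi)=\psi_A(a)\psi_X(\xi)$, $\psi_A(\langle\xi,\eta\rangle_X)=\langle\psi_X(\xi),\psi_X(\eta)\rangle_Y$ and $\psi_A({}_X\langle\xi,\eta\rangle)={}_Y\langle\psi_X(\xi),\psi_X(\eta)\rangle$. The morphism is called injective if $\psi_A$ is injective (then $\psi_X$ is also injective). Morphisms are composed componentwise. An ideal $I$ (closed, two-sided) of $A$ is invariant with respect to $X$ if $IX=XI$. A Hilbert bimodule $(Y,B)$ is an extension of $(X,A)$ if $B$ is a $C^*$-algebra containing $A$ as an ideal, there is a morphism of Hilbert bimodules $(\psi_X,\psi_A):(X,A)\to(Y,B)$ such that $\psi_A$ is the inclusion of $A$ in $B$, and $A$ is invariant with respect to $Y$. The extension is essential if $A$ is an essential ideal in $B$. Multiplier bimodule: $\mathcal L(\cdot,\cdot)$ denotes adjointable operators with respect to the right inner products, and $\mathcal K(X)$ is the closed span in $\mathcal L(X)$ of the operators $\theta_{\eta,\xi}(\zeta)=\eta\langle\xi,\zeta\rangle_X$. View $A$ as a Hilbert bimodule over itself by multiplication, with $\langle a,b\rangle_A=a^*b$ and ${}_A\langle a,b\rangle=ab^*$,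 and identify $M(A)=\mathcal L(A)$. Put $M(X):=\mathcal L(A,X)$. If $(X,A)$ is full, the left action $\phi(a)\xi=a\xi$ is an isomorphism $A\to\mathcal K(X)$ and extends to an isomorphism $\overline\phi:M(A)\to\mathcal L(X)$. Then $(M(X),M(A))$ is a Hilbert bimodule with right action given by composition, left action $(mT)(a)=\overline\phi(m)(T(a))$, right inner product $\langle S,T\rangle_{M(X)}=S^*T$ and left inner product ${}_{M(X)}\langle S,T\rangle=\overline\phi^{-1}(ST^* )$. The canonical embedding is the morphism $(\iota_X,\iota_A):(X,A)\to(M(X),M(A))$, $\iota_X(\xi)(b)=\xi b$, $\iota_A(a)(b)=ab$ for $b\in A$. *)

(* Defs.v *)
From HB Require Import structures.
From mathcomp Require Import all_boot all_order all_algebra.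
From mathcomp Require Import complex.
From mathcomp Require Import boolp classical_sets functions reals.
From mathcomp Require Import topology normedtype.

Set Implicit Arguments.
Unset Strict Implicit.
Unset Printing Implicit Defensive.

Import Order.TTheory GRing.Theory Num.Theory.
Import numFieldNormedType.Exports.

Local Open Scope classical_set_scope.
Local Open Scope ring_scope.

(* The scalars are R[i], with R : realType.  Norms in a normedModType R[i]
   take their values in R[i]; they are nonnegative, hence real.  Algebras need
   not be unital, so they cannot be MathComp rings. *)

HB.mixin Record isStarAlgebra (R : realType) A of GRing.Lmodule R[i] A := {
  amul : A -> A -> A;
  astar : A -> A;
  amulA : forall a b c, amul a (amul b c) = amul (amul a b) c;
  amulDl : forall a b c, amul (a + b) c = amul a c + amul b c;
  amulDr : forall a b c, amul a (b + c) = amul a b + amul a c;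
  amulZl : forall (k : R[i]) a b, amul (k *: a) b = k *: amul a b;
  amulZr : forall (k : R[i]) a b, amul a (k *: b) = k *: amul a b;
  astarK : forall a, astar (astar a) = a;
  astarD : forall a b, astar (a + b) = astar a + astar b;
  astarZ : forall (k : R[i]) a, astar (k *: a) = Num.conj k *: astar a;
  astarM : forall a b, astar (amul a b) = amul (astar b) (astar a)
}.

#[short(type="starAlgType")]
HB.structure Definition StarAlgebra (R : realType) :=
  {A of GRing.Lmodule R[i] A & isStarAlgebra R A}.

HB.mixin Record isCStarAlgebra (R : realType) A
    of CompleteNormedModule R[i] A & StarAlgebra R A := {
  norm_amul : forall a b : A, `|amul a b| <= `|a| * `|b|;
  norm_astar_amul : forall a : A, `|amul (astar a) a| = `|a| ^+ 2
}.

#[short(type="cstarAlgType")]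
HB.structure Definition CStarAlgebra (R : realType) :=
  {A of CompleteNormedModule R[i] A & StarAlgebra R A & isCStarAlgebra R A}.

Definition cstar_ge0 (R : realType) (A : cstarAlgType R) (a : A) : Prop :=
  exists b : A, a = amul (astar b) b.

Section Span.
Variables (R : realType).

Definition linear_span (V : lmodType R[i]) (S : set V) : set V :=
  [set v | exists (n : nat) (k : 'I_n -> R[i]) (w : 'I_n -> V),
     (forall i, S (w i)) /\ v = \sum_(i < n) k i *: w i].

Definition closed_span (V : normedModType R[i]) (S : set V) : set V :=
  closure (linear_span S).

End Span.

(* The operations alone; the axioms come separately, so that morphisms, which
   only involve the operations, also make sense into (M(X), M(A)). *)

HB.mixin Record hasRightInner (R : realType) (A : starAlgType R) X
    of GRing.Lmodule R[i] X := {
  ract : X -> A -> X;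
  rip : X -> X -> A
}.

#[short(type="rightInnerType")]
HB.structure Definition RightInner (R : realType) (A : starAlgType R) :=
  {X of GRing.Lmodule R[i] X & hasRightInner R A X}.

HB.mixin Record hasLeftInner (R : realType) (A : starAlgType R) X
    of GRing.Lmodule R[i] X := {
  lact : A -> X -> X;
  lip : X -> X -> A
}.

#[short(type="leftInnerType")]
HB.structure Definition LeftInner (R : realType) (A : starAlgType R) :=
  {X of GRing.Lmodule R[i] X & hasLeftInner R A X}.

#[short(type="innerBimodType")]
HB.structure Definition InnerBimodule (R : realType) (A : starAlgType R) :=
  {X of GRing.Lmodule R[i] X & hasRightInner R A X & hasLeftInner R A X}.

Arguments ract {R A s}.
Arguments rip {R A s}.
Arguments lact {R A s}.
Arguments lip {R A s}.

HB.mixin Record isRightPreHilbert (R : realType) (A : starAlgType R) X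
    of RightInner R A X := {
  ractDl : forall (x y : X) (a : A), ract (x + y) a = ract x a + ract y a;
  ractDr : forall (x : X) (a b : A), ract x (a + b) = ract x a + ract x b;
  ractZl : forall (k : R[i]) (x : X) (a : A), ract (k *: x) a = k *: ract x a;
  ractZr : forall (k : R[i]) (x : X) (a : A), ract x (k *: a) = k *: ract x a;
  ractA : forall (x : X) (a b : A), ract x (amul a b) = ract (ract x a) b;
  ripDr : forall x y z : X, rip x (y + z) = rip x y + rip x z :> A;
  ripZr : forall (k : R[i]) (x y : X), rip x (k *: y) = k *: rip x y :> A;
  rip_ract : forall (x y : X) (a : A), rip x (ract y a) = amul (rip x y) a;
  rip_star : forall x y : X, rip y x = astar (rip x y) :> A;
  rip_eq0 : forall x : X, rip x x = 0 :> A -> x = 0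
}.

#[short(type="rightPreHilbertType")]
HB.structure Definition RightPreHilbert (R : realType) (A : starAlgType R) :=
  {X of RightInner R A X & isRightPreHilbert R A X}.

HB.mixin Record isLeftPreHilbert (R : realType) (A : starAlgType R) X
    of LeftInner R A X := {
  lactDl : forall (a b : A) (x : X), lact (a + b) x = lact a x + lact b x;
  lactDr : forall (a : A) (x y : X), lact a (x + y) = lact a x + lact a y;
  lactZl : forall (k : R[i]) (a : A) (x : X), lact (k *: a) x = k *: lact a x;
  lactZr : forall (k : R[i]) (a : A) (x : X), lact a (k *: x) = k *: lact a x;
  lactA : forall (a b : A) (x : X), lact (amul a b) x = lact a (lact b x);
  lipDl : forall x y z : X, lip (x + y) z = lip x z + lip y z :> A;
  lipZl : forall (k : R[i]) (x y : X), lip (k *: x) y = k *: lip x y :> A;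
  lip_lact : forall (a : A) (x y : X), lip (lact a x) y = amul a (lip x y);
  lip_star : forall x y : X, lip y x = astar (lip x y) :> A;
  lip_eq0 : forall x : X, lip x x = 0 :> A -> x = 0
}.

#[short(type="leftPreHilbertType")]
HB.structure Definition LeftPreHilbert (R : realType) (A : starAlgType R) :=
  {X of LeftInner R A X & isLeftPreHilbert R A X}.

(* An action is non-degenerate when the products span a dense subspace; by the
   Cohen-Hewitt factorization theorem the products then exhaust X. *)

HB.mixin Record isRightHilbert (R : realType) (A : cstarAlgType R) X
    of CompleteNormedModule R[i] X & RightPreHilbert R A X := {
  ract_nondegenerate :
    closed_span [set z : X | exists x (a : A), z = ract x a] = setT;
  rip_ge0 : forall x : X, cstar_ge0 (rip x x : A);
  norm_rip : forall x : X, `|x| ^+ 2 = `|rip x x : A|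
}.

#[short(type="rightHilbertType")]
HB.structure Definition RightHilbert (R : realType) (A : cstarAlgType R) :=
  {X of CompleteNormedModule R[i] X & RightPreHilbert R A X
     & isRightHilbert R A X}.

HB.mixin Record isLeftHilbert (R : realType) (A : cstarAlgType R) X
    of CompleteNormedModule R[i] X & LeftPreHilbert R A X := {
  lact_nondegenerate :
    closed_span [set z : X | exists (a : A) x, z = lact a x] = setT;
  lip_ge0 : forall x : X, cstar_ge0 (lip x x : A);
  norm_lip : forall x : X, `|x| ^+ 2 = `|lip x x : A|
}.

#[short(type="leftHilbertType")]
HB.structure Definition LeftHilbert (R : realType) (A : cstarAlgType R) :=
  {X of CompleteNormedModule R[i] X & LeftPreHilbert R A X
     & isLeftHilbert R A X}.

HB.mixin Record isHilbertBimodule (R : realType) (A : cstarAlgType R) X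
    of RightHilbert R A X & LeftHilbert R A X := {
  lact_lip : forall x y z : X, lact (lip x y : A) z = ract x (rip y z : A)
}.

#[short(type="hilbertBimodType")]
HB.structure Definition HilbertBimodule (R : realType) (A : cstarAlgType R) :=
  {X of RightHilbert R A X & LeftHilbert R A X & isHilbertBimodule R A X}.

Definition full_bimod (R : realType) (A : cstarAlgType R)
    (X : hilbertBimodType A) : Prop :=
  closed_span [set a : A | exists x y : X, a = lip x y] = setT /\
  closed_span [set a : A | exists x y : X, a = rip x y] = setT.

Definition star_morphism (R : realType) (A B : starAlgType R) (f : A -> B) :
    Prop :=
  [/\ linear f, forall a b, f (amul a b) = amul (f a) (f b)
    & forall a, f (astar a) = astar (f a)].

Definition bimod_morphism (R : realType) (A B : starAlgType R)
    (X : innerBimodType A) (Y : innerBimodType B)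
    (f : (X -> Y) * (A -> B)) : Prop :=
  [/\ linear f.1 /\ star_morphism f.2,
      forall x a, f.1 (ract x a) = ract (f.1 x) (f.2 a),
      forall a x, f.1 (lact a x) = lact (f.2 a) (f.1 x),
      forall x y, f.2 (rip x y) = rip (f.1 x) (f.1 y)
    & forall x y, f.2 (lip x y) = lip (f.1 x) (f.1 y)].

Definition bimod_comp (X Y Z A B C : Type)
    (g : (Y -> Z) * (B -> C)) (f : (X -> Y) * (A -> B)) :
    (X -> Z) * (A -> C) :=
  (g.1 \o f.1, g.2 \o f.2).

Definition injective_morphism (X Y A B : Type) (f : (X -> Y) * (A -> B)) :
    Prop :=
  injective f.2.

Definition is_ideal (R : realType) (B : cstarAlgType R) (I : set B) : Prop :=
  [/\ closed I, I 0, forall (k : R[i]) a b, I a -> I b -> I (k *: a + b)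
    & forall a b, I a -> I (amul a b) /\ I (amul b a)].

Definition is_essential_ideal (R : realType) (B : cstarAlgType R) (I : set B) :
    Prop :=
  is_ideal I /\
  forall J : set B, is_ideal J -> J != [set 0] -> I `&` J != [set 0].

Definition ideal_lact (R : realType) (B : cstarAlgType R)
    (Y : hilbertBimodType B) (I : set B) : set Y :=
  closed_span [set z | exists b y, I b /\ z = lact b y].

Arguments ideal_lact {R B} Y I.

Definition ideal_ract (R : realType) (B : cstarAlgType R)
    (Y : hilbertBimodType B) (I : set B) : set Y :=
  closed_span [set z | exists y b, I b /\ z = ract y b].

Arguments ideal_ract {R B} Y I.

Definition is_invariant (R : realType) (B : cstarAlgType R)
    (Y : hilbertBimodType B) (I : set B) : Prop :=
  is_ideal I /\ ideal_lact Y I = ideal_ract Y I.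

(* "B contains A as an ideal and f.2 is the inclusion": f.2 is an isometric
   *-homomorphism whose range is an ideal of B. *)
Definition is_extension (R : realType) (A B : cstarAlgType R)
    (X : hilbertBimodType A) (Y : hilbertBimodType B)
    (f : (X -> Y) * (A -> B)) : Prop :=
  [/\ bimod_morphism f, forall a, `|f.2 a| = `|a|, is_ideal (range f.2)
    & is_invariant Y (range f.2)].

Definition is_essential_extension (R : realType) (A B : cstarAlgType R)
    (X : hilbertBimodType A) (Y : hilbertBimodType B)
    (f : (X -> Y) * (A -> B)) : Prop :=
  is_extension f /\ is_essential_ideal (range f.2).

(* A as a right module over itself. *)
Definition regular_mod (R : realType) (A : cstarAlgType R) : Type := A.

Section RegularModule.
Variables (R : realType) (A : cstarAlgType R).

HB.instance Definition _ :=
  GRing.Lmodule.copy (regular_mod A) (CStarAlgebra.sort A).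

HB.instance Definition _ := hasRightInner.Build R A (regular_mod A)
  (fun a b : A => amul a b) (fun a b : A => amul (astar a) b).

Fact regular_rip_star (a b : A) :
  amul (astar b) a = astar (amul (astar a) b).
Proof. by rewrite astarM astarK. Qed.

Fact regular_rip_eq0 (a : A) : amul (astar a) a = 0 -> a = 0.
Proof.
move=> /(congr1 (fun x : A => `|x|)); rewrite norm_astar_amul normr0.
by move/eqP; rewrite expf_eq0 /= normr_eq0 => /eqP.
Qed.

HB.instance Definition _ := isRightPreHilbert.Build R A (regular_mod A)
  (@amulDl R A) (@amulDr R A) (@amulZl R A) (fun k a b => amulZr k a b)
  (fun x a b => amulA x a b) (fun x y z => amulDr _ y z)
  (fun k x y => amulZr k _ y)
  (fun x y a => amulA _ y a) regular_rip_star regular_rip_eq0.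

End RegularModule.

Section Adjointable.
Variables (R : realType) (A : starAlgType R).
Implicit Types E F G H : rightPreHilbertType A.

Definition is_adjoint E F (T : E -> F) (S : F -> E) : Prop :=
  forall x y, rip (T x) y = rip x (S y) :> A.

Definition adjointable E F : pred (E -> F) :=
  fun T => `[< exists S : F -> E, is_adjoint T S >].

Fact rip0r E (x : E) : rip x 0 = 0 :> A.
Proof. by have := ripZr (0 : R[i]) x (0 : E); rewrite !scale0r. Qed.

Fact rip0l E (x : E) : rip 0 x = 0 :> A.
Proof.
rewrite rip_star rip0r.
by have := astarZ (0 : R[i]) (0 : A); rewrite conjC0 !scale0r.
Qed.

Fact ripDl E (x y z : E) : rip (x + y) z = rip x z + rip y z :> A.
Proof. by rewrite rip_star ripDr astarD -!rip_star. Qed.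

Fact ripZl E k (x y : E) : rip (k *: x) y = Num.conj k *: rip x y :> A.
Proof. by rewrite rip_star ripZr astarZ -rip_star. Qed.

Fact rip_inj E (x y : E) : (forall z, rip z x = rip z y :> A) -> x = y.
Proof.
move=> xy; apply/subr0_eq/(@rip_eq0 R A); set z := x - y.
rewrite {2}/z ripDr xy -ripDr subrr.
exact: rip0r.
Qed.

Fact adjointable_submod_closed E F : submod_closed (@adjointable E F).
Proof.
split; first by apply/asboolP; exists (fun=> 0) => x y; rewrite rip0l rip0r.
move=> k T1 T2 /asboolP[S1 TS1] /asboolP[S2 TS2]; apply/asboolP.
exists (Num.conj k *: S1 + S2) => x y.
by rewrite ripDl ripZl TS1 TS2 -ripZr -ripDr.
Qed.

HB.instance Definition _ E F :=
  GRing.isSubmodClosed.Build R[i] (E -> F) (@adjointable E F)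
    (@adjointable_submod_closed E F).

(* L(E, F); linearity and, between Hilbert modules, boundedness of adjointable
   maps are automatic. *)
Record adjoint_op E F := AdjointOp {
  adjoint_fun :> E -> F;
  adjoint_funP : adjointable adjoint_fun
}.

HB.instance Definition _ E F := [isSub for @adjoint_fun E F].
HB.instance Definition _ E F := [Choice of adjoint_op E F by <:].
HB.instance Definition _ E F :=
  [SubChoice_isSubLmodule of adjoint_op E F by <:].

Definition mk_adjoint_op E F T S (TS : is_adjoint T S) : adjoint_op E F :=
  AdjointOp (introT (asboolP _) (ex_intro _ S TS)).

Definition adj_fun E F (T : adjoint_op E F) : F -> E :=
  sval (cid (elimT (asboolP _) (adjoint_funP T))).

Fact adj_funP E F (T : adjoint_op E F) : is_adjoint T (adj_fun T).
Proof. exact: svalP (cid _). Qed.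

Fact is_adjointC E F (T : E -> F) (S : F -> E) :
  is_adjoint T S -> is_adjoint S T.
Proof. by move=> TS x y; rewrite rip_star -TS -rip_star. Qed.

Definition adj E F (T : adjoint_op E F) : adjoint_op F E :=
  mk_adjoint_op (is_adjointC (adj_funP T)).

Fact is_adjoint_comp E F G (T : adjoint_op F G) (S : adjoint_op E F) :
  is_adjoint (T \o S) (adj_fun S \o adj_fun T).
Proof. by move=> x y /=; rewrite adj_funP adj_funP. Qed.

Definition adj_comp E F G (T : adjoint_op F G) (S : adjoint_op E F) :
    adjoint_op E G :=
  mk_adjoint_op (is_adjoint_comp T S).

Fact adjP E F (T : adjoint_op E F) : is_adjoint T (adj T).
Proof. exact: adj_funP. Qed.

Fact adjoint_opP E F (S T : adjoint_op E F) : S =1 T -> S = T.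
Proof. by move=> ST; apply/val_inj/funext. Qed.

Fact is_adjoint_unique E F (T : adjoint_op E F) (S : adjoint_op F E) :
  is_adjoint T S -> adj T = S.
Proof.
by move=> TS; apply/adjoint_opP => y; apply: rip_inj => x; rewrite -TS adjP.
Qed.

Fact adj_compA E F G H (T : adjoint_op G H) (S : adjoint_op F G)
    (U : adjoint_op E F) :
  adj_comp T (adj_comp S U) = adj_comp (adj_comp T S) U.
Proof. exact: adjoint_opP. Qed.

Fact adj_compDl E F G (T S : adjoint_op F G) (U : adjoint_op E F) :
  adj_comp (T + S) U = adj_comp T U + adj_comp S U.
Proof. exact: adjoint_opP. Qed.

Fact adj_compZl E F G k (T : adjoint_op F G) (U : adjoint_op E F) :
  adj_comp (k *: T) U = k *: adj_comp T U.
Proof. exact: adjoint_opP. Qed.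

Fact adjoint_opD E F (T : adjoint_op E F) x y : T (x + y) = T x + T y.
Proof.
apply: rip_inj => z; have T' := is_adjointC (adjP T).
by rewrite ripDr -!T' ripDr.
Qed.

Fact adjoint_opZ E F (T : adjoint_op E F) k x : T (k *: x) = k *: T x.
Proof.
apply: rip_inj => z; have T' := is_adjointC (adjP T).
by rewrite ripZr -!T' ripZr.
Qed.

Fact adj_compDr E F G (T : adjoint_op F G) (S U : adjoint_op E F) :
  adj_comp T (S + U) = adj_comp T S + adj_comp T U.
Proof. by apply: adjoint_opP => x; exact: adjoint_opD. Qed.

Fact adj_compZr E F G k (T : adjoint_op F G) (U : adjoint_op E F) :
  adj_comp T (k *: U) = k *: adj_comp T U.
Proof. by apply: adjoint_opP => x; exact: adjoint_opZ. Qed.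

Fact adjK E F (T : adjoint_op E F) : adj (adj T) = T.
Proof. exact/is_adjoint_unique/is_adjointC/adjP. Qed.

Fact adjD E F (S T : adjoint_op E F) : adj (S + T) = adj S + adj T.
Proof.
apply: is_adjoint_unique => x y.
by rewrite /= /+%R /= ripDl !adjP -ripDr.
Qed.

Fact adjZ E F k (T : adjoint_op E F) : adj (k *: T) = Num.conj k *: adj T.
Proof.
by apply: is_adjoint_unique => x y; rewrite ripZl adjP -ripZr.
Qed.

Fact adjM E F G (T : adjoint_op F G) (S : adjoint_op E F) :
  adj (adj_comp T S) = adj_comp (adj S) (adj T).
Proof. by apply: is_adjoint_unique => x y; rewrite /= !adjP. Qed.

End Adjointable.

Section MultiplierAlgebra.
Variables (R : realType) (A : cstarAlgType R).

Definition multiplier : Type := adjoint_op (regular_mod A) (regular_mod A).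

HB.instance Definition _ := GRing.Lmodule.on multiplier.

HB.instance Definition _ := isStarAlgebra.Build R multiplier
  (@adj_compA R A _ _ _ _) (@adj_compDl R A _ _ _) (@adj_compDr R A _ _ _)
  (fun k T U => adj_compZl k T U) (fun k T U => adj_compZr k T U)
  (@adjK R A _ _) (@adjD R A _ _) (@adjZ R A _ _) (@adjM R A _ _ _).

Fact iota_alg_subproof (a : A) :
  is_adjoint (fun b : regular_mod A => amul a b : regular_mod A)
             (fun b : regular_mod A => amul (astar a) b : regular_mod A).
Proof. by move=> x y; rewrite /rip /= astarM amulA. Qed.

Definition iota_alg (a : A) : multiplier := mk_adjoint_op (iota_alg_subproof a).

End MultiplierAlgebra.

Section MultiplierBimodule.
Variables (R : realType) (A : cstarAlgType R) (X : hilbertBimodType A).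

Definition mult_bimod : Type := adjoint_op (regular_mod A) X.

HB.instance Definition _ := GRing.Lmodule.on mult_bimod.

(* The extension to M(A) = L(A) of the left action A -> K(X): the only T in
   L(X) such that T (a x) = (m a) x for all a and x.  It exists whenever X is
   non-degenerate; the default value 0 is then never used. *)
Definition phi_bar (m : multiplier A) : adjoint_op X X :=
  xget 0 [set T : adjoint_op X X |
    forall (a : A) (x : X), T (lact a x) = lact (m a : A) x].

(* The inverse of phi_bar, which is bijective when X is full; the default value
   0 is then never used. *)
Definition phi_bar_inv (T : adjoint_op X X) : multiplier A :=
  xget 0 [set m | phi_bar m = T].

HB.instance Definition _ := hasRightInner.Build R (multiplier A) mult_bimod
  (fun (T : mult_bimod) (m : multiplier A) => adj_comp T m : mult_bimod)
  (fun S T : mult_bimod => adj_comp (adj S) T : multiplier A).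

HB.instance Definition _ := hasLeftInner.Build R (multiplier A) mult_bimod
  (fun (m : multiplier A) (T : mult_bimod) =>
     adj_comp (phi_bar m) T : mult_bimod)
  (fun S T : mult_bimod => phi_bar_inv (adj_comp S (adj T))).

Fact iota_mod_subproof (x : X) :
  is_adjoint (fun b : regular_mod A => ract x (b : A))
             (fun y : X => rip x y : regular_mod A).
Proof.
move=> b y; rewrite rip_star rip_ract astarM -rip_star.
by [].
Qed.

Definition iota_mod (x : X) : mult_bimod := mk_adjoint_op (iota_mod_subproof x).

Definition iota_bimod : (X -> mult_bimod) * (A -> multiplier A) :=
  (iota_mod, @iota_alg R A).

End MultiplierBimodule.

Arguments iota_bimod {R A} X.

(* Main.v *)
Require Import Defs.
From HB Require Import structures.
From mathcomp Require Import all_boot all_order all_algebra.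
From mathcomp Require Import complex.
From mathcomp Require Import boolp classical_sets functions reals.
From mathcomp Require Import topology normedtype.
From mathcomp Require Import ring lra.

(** The maps are forced: composing with the embedding of A and evaluating on
    A = psi_A(A) shows that any morphism extending (iota_X, iota_A) satisfies
    [psi_A (lambda_B(b) a) = b psi_A(a)] and
    [psi_X (lambda_Y(y) a) = y psi_A(a)] ([morphism_algE], [morphism_modE]).
    These two equations are taken as definitions.  The right-hand sides lie in
    the ranges of psi_A and psi_X: psi_A(A) is an ideal of B, and
    [Y psi_A(A) = psi_A(A) Y] is contained in psi_X(X).  For the latter
    ([extension_lact]), fullness of X reduces to elements
    [lip (psi_X u) (psi_X v)] of psi_A(A), which send y to
    [psi_X(u) rip(psi_X v, y)], and [rip(psi_X v, y)] lies in psi_A(A) because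
    X is the closed span of XA; closedness of psi_X(X), as psi_X is isometric,
    then concludes, and invariance exchanges the two sides
    ([extension_ract]).  The adjoint of lambda_Y(y) is
    [x |-> psi_A^-1 rip(y, psi_X x)].  All the axioms of a morphism follow by
    applying the injective maps psi_X and psi_A.

    The left action and left inner product of M(X) are given through the map
    [phi_bar : M(A) -> L(X)], so one has to know that it is everywhere defined
    and injective.  For a multiplier m, the operator T = phi_bar m is
    characterized by [lip (T x) z = m (lip x z)] for all z.  The vectors x for
    which such a T x exists form a subspace containing the products
    a x, with T (a x) = (m a) x.  It is closed, because
    [|T x|^2 = |m (lip x (T x))| <= 4 |m| |x| |T x|]
    bounds T ([phi_graph_bounded]).  Here m is bounded by the uniform
    boundedness principle applied to the maps [b |-> (m a)^* b = a^* (m^* b)].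
    The bound [|rip x y| <= 4 |x| |y|] that is used for continuity comes from
    polarization, so that the argument avoids functional calculus and
    approximate units.

    Finally the kernel of lambda_B is the annihilator of psi_A(A) in B, an
    ideal which meets psi_A(A) trivially; and an ideal meeting psi_A(A)
    trivially is contained in that annihilator.  Hence lambda_B is injective
    exactly when psi_A(A) is essential. *)

Set Implicit Arguments.
Unset Strict Implicit.
Unset Printing Implicit Defensive.

Import Order.TTheory GRing.Theory Num.Theory.
Import numFieldNormedType.Exports.

Local Open Scope classical_set_scope.
Local Open Scope ring_scope.

(** * Linear maps, real-valued norms, closed subspaces, uniform boundedness *)

Section LinearMaps.
Variables (K : pzRingType) (V W : lmodType K) (f : V -> W).
Hypothesis lf : linear f.

Lemma linear_map0 : f 0 = 0.
Proof. by have := lf (-1) 0 0; rewrite scaler0 add0r scaleN1r addNr. Qed.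

Lemma linear_mapD x y : f (x + y) = f x + f y.
Proof. by have := lf 1 x y; rewrite !scale1r. Qed.

Lemma linear_mapZ k x : f (k *: x) = k *: f x.
Proof. by have := lf k x 0; rewrite linear_map0 !addr0. Qed.

Lemma linear_mapB x y : f (x - y) = f x - f y.
Proof. by rewrite linear_mapD -scaleN1r linear_mapZ scaleN1r. Qed.

End LinearMaps.

Section RealNorm.
Variable R : realType.
Implicit Types V W : normedModType R[i].

(** The norm of a normed space over [R[i]] takes values in [R[i]], where only
    nonnegative reals occur; [rnorm] is the same norm as an element of R. *)
Definition rnorm V (x : V) : R := complex.Re `|x|.

Lemma rnormE V (x : V) : `|x| = ((rnorm x)%:C)%C.
Proof.
have := ger0_Im (normr_ge0 x); rewrite /rnorm.
by case: `|x| => a b /= ->.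
Qed.

Lemma rnorm_ge0 V (x : V) : 0 <= rnorm x.
Proof. by rewrite -lecR -rnormE normr_ge0. Qed.

Lemma rnorm0 V : rnorm (0 : V) = 0.
Proof. by rewrite /rnorm normr0. Qed.

Lemma rnorm_eq0 V (x : V) : rnorm x = 0 -> x = 0.
Proof. by move=> x0; apply/eqP; rewrite -normr_eq0 rnormE x0. Qed.

Lemma rnormN V (x : V) : rnorm (- x) = rnorm x.
Proof. by rewrite /rnorm normrN. Qed.

Lemma rnormB V (x y : V) : rnorm (x - y) = rnorm (y - x).
Proof. by rewrite -rnormN opprB. Qed.

Lemma rnormD V (x y : V) : rnorm (x + y) <= rnorm x + rnorm y.
Proof. by rewrite -lecR rmorphD /= -!rnormE ler_normD. Qed.

Lemma rnorm_triangle V (y x z : V) :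
  rnorm (x - z) <= rnorm (x - y) + rnorm (y - z).
Proof. by apply: le_trans (rnormD _ _); rewrite addrA subrK. Qed.

Lemma rnormZ V k (x : V) : rnorm (k *: x) = complex.Re `|k| * rnorm x.
Proof.
have k0 := ger0_Im (normr_ge0 k).
rewrite /rnorm normrZ rnormE; case: `|k| k0 => a b /= ->.
by rewrite mul0r subr0.
Qed.

Lemma rnormZR V (t : R) (x : V) : rnorm (t%:C%C *: x) = `|t| * rnorm x.
Proof. by rewrite rnormZ normc_def /= expr0n addr0 sqrtr_sqr. Qed.

Lemma inv_succ_lt (e : R) : 0 < e -> exists n : nat, n.+1%:R^-1 < e.
Proof.
move=> e0; exists (Num.Def.archi_bound e^-1).
rewrite invf_plt ?posrE // (lt_trans (archi_boundP _)) ?invr_ge0 ?ltW //.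
by rewrite ltr_nat.
Qed.

(** The error term is allowed a constant factor [C], possibly zero. *)
Lemma le_eps (a b C : R) : 0 <= C ->
  (forall e, 0 < e -> a <= b + C * e) -> a <= b.
Proof.
move=> C0 ab; apply/ler_addgt0Pr => e e0.
have C1 : 0 < C + 1 by lra.
apply: le_trans (ab (e / (C + 1)) _) _; first exact: divr_gt0.
rewrite lerD2l mulrA ler_pdivrMr // mulrDr mulr1 mulrC lerDl; exact: ltW.
Qed.

Lemma nbhs_rball V (x : V) (S : set V) :
  nbhs x S <-> exists2 e : R, 0 < e & forall y, rnorm (x - y) < e -> S y.
Proof.
split.
  move/nbhs_ballP => [e /= e0 eS].
  have eE : e = ((complex.Re e)%:C)%C.
    by have := ger0_Im (ltW e0); case: e e0 eS => a b /= _ _ ->.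
  exists (complex.Re e); first by rewrite -ltcR -eE.
  by move=> y xy; apply: eS; rewrite -ball_normE /ball_ /= rnormE eE ltcR.
move=> [e e0 eS]; apply/nbhs_ballP; exists (e%:C)%C; first by rewrite /= ltcR.
by move=> y; rewrite -ball_normE /ball_ /= rnormE ltcR; exact: eS.
Qed.

Lemma closed_rnormP V (P : set V) : closed P <->
  forall x, (forall e : R, 0 < e -> exists2 y, P y & rnorm (x - y) < e) -> P x.
Proof.
split=> [cP x Px|Px x xP].
  apply: cP => S /nbhs_rball[e e0 eS].
  by have [y Py xy] := Px e e0; exists y; split => //; apply: eS.
apply: Px => e e0.
have [y [Py xy]] : P `&` [set y | rnorm (x - y) < e] !=set0.
  by apply: xP; apply/nbhs_rball; exists e.
by exists y.
Qed.

(** Convergence with an explicit modulus [r]: all later terms stay within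
    distance [r n] of the n-th one, and so does the limit. *)
Lemma cauchy_rnorm_cvg (V : completeNormedModType R[i]) (u : nat -> V)
    (r : nat -> R) :
  (forall e, 0 < e -> exists n, r n < e) ->
  (forall n m, (n <= m)%N -> rnorm (u n - u m) <= r n) ->
  exists l, forall n, rnorm (u n - l) <= r n.
Proof.
move=> r0 ur.
have /cauchy_cvg/cvg_ex[l ul] : cauchy (u @ \oo).
  apply/cauchy_ballP => e e0.
  have [s s0 se] : exists2 s : R, 0 < s & (s%:C <= e)%C.
    exists (complex.Re e).
      by have := e0; rewrite ltcE /= => /andP[].
    by have := ger0_Im (ltW e0); case: e {e0} => a b /= ->.
  have [n rn] := r0 (s / 2) ltac:(by rewrite divr_gt0).
  have nu : (u @ \oo) [set x | rnorm (u n - x) < s / 2].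
    by exists n => // m /= nm; apply: le_lt_trans (ur _ _ nm) rn.
  exists ([set x | rnorm (u n - x) < s / 2], [set x | rnorm (u n - x) < s / 2]).
    by split.
  case=> x y /= [xn yn]; rewrite -ball_normE /ball_ /=.
  apply: lt_le_trans se; rewrite rnormE ltcR.
  by have := rnorm_triangle (u n) x y; rewrite (rnormB x (u n)); lra.
exists l => n; apply: (@le_eps _ _ 1) => // e e0; rewrite mul1r.
have /ul[N _ NP] : nbhs l [set y | rnorm (l - y) < e].
  by apply/nbhs_rball; exists e.
have := NP (maxn n N) (leq_maxr _ _) => /= lN.
have := ur n (maxn n N) (leq_maxl _ _).
by have := rnorm_triangle (u (maxn n N)) (u n) l; rewrite (rnormB l) in lN; lra.
Qed.

(** Closed linear subspaces, as sets rather than as a bundled type. *)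
Definition closed_subspace V (P : set V) : Prop :=
  [/\ closed P, P 0 & forall k a b, P a -> P b -> P (k *: a + b)].

Lemma closed_span_min V (S P : set V) :
  closed_subspace P -> S `<=` P -> closed_span S `<=` P.
Proof.
move=> [cP P0 PD] SP; rewrite /closed_span closureE; apply: smallest_sub => //.
move=> _ [n [k [w [Sw ->]]]]; elim/big_rec : _ => // i x _ Px.
by apply: PD => //; apply: SP.
Qed.

Lemma sub_closed_span V (S : set V) : S `<=` closed_span S.
Proof.
move=> x Sx; apply: subset_closure; exists 1%N, (fun=> 1), (fun=> x).
by split=> //; rewrite big_ord1 scale1r.
Qed.

Lemma closed_subspace_forall V (I : Type) (P : I -> set V) :
  (forall i, closed_subspace (P i)) ->
  closed_subspace [set x | forall i, P i x].
Proof.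
move=> cP; split=> [|i|k a b Pa Pb i].
- apply/closed_rnormP => x Px i; have [/closed_rnormP + _ _] := cP i; apply.
  by move=> e /Px[y Py xy]; exists y.
- by case: (cP i).
- by have [_ _] := cP i; apply; [apply: Pa|apply: Pb].
Qed.

Lemma closed_subspace0 V : closed_subspace [set (0 : V)].
Proof.
split=> [||k a b /= -> ->] //; last by rewrite scaler0 addr0.
apply/closed_rnormP => x x0 /=; apply: rnorm_eq0; apply/eqP.
rewrite eq_le rnorm_ge0 andbT; apply: (@le_eps _ _ 1) => // e.
by rewrite add0r mul1r => /x0[_ /= ->]; rewrite subr0; apply: ltW.
Qed.

(** The bound on f stands for its continuity; the constant C is arbitrary, as
    it is only used through its absolute value. *)
Lemma closed_subspace_preim V W (f : V -> W) (C : R) (P : set W) :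
  linear f -> (forall x, rnorm (f x) <= C * rnorm x) ->
  closed_subspace P -> closed_subspace [set x | P (f x)].
Proof.
move=> lf fC [cP P0 PD].
have f0 := linear_map0 lf.
split=> /= [||k a b Pa Pb]; [|by rewrite f0|by rewrite lf; apply: PD].
apply/closed_rnormP => x Px /=; move/closed_rnormP : cP; apply=> e e0.
have C1 : 0 < `|C| + 1 by have := normr_ge0 C; lra.
have [y Py xy] := Px (e / (`|C| + 1)) ltac:(exact: divr_gt0).
exists (f y) => //; rewrite -(linear_mapB lf).
apply: le_lt_trans (fC _) _.
apply: (@le_lt_trans _ _ ((`|C| + 1) * rnorm (x - y))).
  by apply: ler_wpM2r; [exact: rnorm_ge0|have := ler_norm C; lra].
by rewrite mulrC -ltr_pdivlMr.
Qed.

Lemma closed_subspace_eq V W (f g : V -> W) (C D : R) :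
  linear f -> linear g -> (forall x, rnorm (f x) <= C * rnorm x) ->
  (forall x, rnorm (g x) <= D * rnorm x) ->
  closed_subspace [set x | f x = g x].
Proof.
move=> lf lg fC gD.
have -> : [set x | f x = g x] = [set x | [set (0 : W)] (f x - g x)].
  by apply/seteqP; split=> x /= => [->|/subr0_eq]; rewrite ?subrr.
apply: (@closed_subspace_preim _ _ _ (C + D) _ _ _ (closed_subspace0 W)).
  by move=> k x y /=; rewrite lf lg scalerBr opprD addrACA.
move=> x; apply: le_trans (rnormD _ _) _; rewrite rnormN mulrDl.
exact: lerD.
Qed.

(** The domain of a closed bounded linear graph is closed.  It is used both to
    extend a bounded densely defined map by continuity, and, exchanging the
    two sides of the graph, to see that an isometry has closed range. *)
Lemma closed_subspace_dom V (W : completeNormedModType R[i])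
    (G : V -> W -> Prop) (C : R) :
  G 0 0 ->
  (forall k v w v' w', G v w -> G v' w' -> G (k *: v + v') (k *: w + w')) ->
  (forall v w, G v w -> rnorm w <= C * rnorm v) ->
  (forall v w, (forall e : R, 0 < e -> exists v' w',
     [/\ G v' w', rnorm (v - v') < e & rnorm (w - w') < e]) -> G v w) ->
  closed_subspace [set v | exists w, G v w].
Proof.
move=> G0 GD GC Gcl; split=> [||k a b [wa Ga] [wb Gb]] /=; last 2 first.
- by exists 0.
- by exists (k *: wa + wb); apply: GD.
apply/closed_rnormP => v vG.
have n0 n : 0 < (n.+1%:R^-1 : R) by rewrite invr_gt0.
have /choice[p pP] : forall n : nat, exists p : V * W,
    G p.1 p.2 /\ rnorm (v - p.1) < n.+1%:R^-1.
  by move=> n; have [y [w Gw] yv] := vG _ (n0 n); exists (y, w).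
have C1 : 0 < `|C| + 1 by have := normr_ge0 C; lra.
have [| |w wP] := @cauchy_rnorm_cvg _ (fun n => (p n).2)
    (fun n => (`|C| + 1) * (2 * n.+1%:R^-1)).
- move=> e e0.
  have [n ne] := inv_succ_lt (divr_gt0 (divr_gt0 e0 C1) (ltr0n _ 2)).
  by exists n; rewrite mulrC -ltr_pdivlMr // mulrC -ltr_pdivlMr.
- move=> n m nm; have [Gn pn] := pP n; have [Gm pm] := pP m.
  have GB : G ((p n).1 - (p m).1) ((p n).2 - (p m).2).
    rewrite addrC -scaleN1r [_.2 - _]addrC -[- (p m).2]scaleN1r.
    exact: GD.
  apply: le_trans (GC _ _ GB) _.
  apply: (@le_trans _ _ ((`|C| + 1) * rnorm ((p n).1 - (p m).1))).
    by apply: ler_wpM2r; [exact: rnorm_ge0|have := ler_norm C; lra].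
  apply: ler_wpM2l; first exact: ltW.
  have mn : (m.+1%:R^-1 : R) <= n.+1%:R^-1 by rewrite lef_pV2 ?posrE // ler_nat.
  have := rnorm_triangle v (p n).1 (p m).1; rewrite (rnormB (p n).1 v).
  move: pn pm mn; move: (n.+1%:R^-1) (m.+1%:R^-1) => s t; lra.
exists w; apply: Gcl => e e0.
have K0 : 0 < 2 * (`|C| + 1) + 1 by lra.
have [n ne] := inv_succ_lt (divr_gt0 e0 K0).
have [Gn pn] := pP n; exists (p n).1, (p n).2; split => //.
  apply: (lt_trans pn); apply: (lt_le_trans ne).
  by rewrite ler_pdivrMr // ler_peMr ?(ltW e0) //; lra.
rewrite rnormB; apply: le_lt_trans (wP n) _.
move: ne; rewrite ltr_pdivlMr // => ne.
by move: (n0 n) ne => /=; move: (n.+1%:R^-1) => s; lra.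
Qed.

(** The Banach-Steinhaus theorem over the complex scalars.  If no uniform bound
    exists, every ball contains a smaller closed ball on which some f i is
    everywhere larger than n; the centres of a decreasing sequence of such
    balls converge to a point where the family is not bounded. *)
Lemma uniform_boundedness (V : completeNormedModType R[i])
    (W : normedModType R[i]) (I : Type) (f : I -> V -> W) :
  (forall i, linear (f i)) ->
  (forall i, exists C, forall x, rnorm (f i x) <= C * rnorm x) ->
  (forall x, exists M, forall i, rnorm (f i x) <= M) ->
  exists C, forall i x, rnorm (f i x) <= C * rnorm x.
Proof.
move=> lf bf pf; apply/not_existsP => nC.
have f0 i : f i 0 = 0 := linear_map0 (lf i).
have fD i x y : f i (x + y) = f i x + f i y := linear_mapD (lf i) x y.
have fZ i k x : f i (k *: x) = k *: f i x := linear_mapZ (lf i) k x.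
have fB i x y : f i (x - y) = f i x - f i y := linear_mapB (lf i) x y.
have step (n : nat) (q : V * R) : exists q' : V * R, 0 < q.2 ->
    [/\ 0 < q'.2, q'.2 <= n.+1%:R^-1,
        forall z, rnorm (z - q'.1) <= q'.2 -> rnorm (z - q.1) <= q.2
      & exists i, forall z, rnorm (z - q'.1) <= q'.2 -> n%:R < rnorm (f i z)].
  case: q => x0 r /=.
  have [r0|r0] := ltP 0 r; last by exists (0, 0).
  (* With this constant, the multiple of u of norm r / 2 is sent above n + 1. *)
  have /existsNP[i /existsNP[u /negP]] := nC (2 * (n.+1%:R / r)).
  rewrite -ltNge => uP.
  have u0 : 0 < rnorm u.
    rewrite lt_neqAle rnorm_ge0 andbT eq_sym; apply/negP => /eqP /rnorm_eq0 u0.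
    by move: uP; rewrite u0 f0 !rnorm0 mulr0 ltxx.
  pose u' := ((r / 2 / rnorm u)%:C)%C *: u.
  have u'r : rnorm u' = r / 2.
    by rewrite rnormZR ger0_norm ?divr_ge0 ?rnorm_ge0 ?ltW // divfK // gt_eqF.
  have u'P : n.+1%:R < rnorm (f i u').
    rewrite fZ rnormZR ger0_norm ?divr_ge0 ?rnorm_ge0 ?ltW //.
    rewrite mulrAC ltr_pdivlMr // [ltRHS]mulrC.
    have := uP; rewrite -(ltr_pM2r r0).
    have -> : 2 * (n.+1%:R / r) * rnorm u * r = 2 * (n.+1%:R * rnorm u).
      by field; rewrite gt_eqF.
    by lra.
  have [x1 x1r x1P] : exists2 x1, rnorm (x1 - x0) <= r / 2 &
      n.+1%:R < rnorm (f i x1).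
    (* f i (x0 + u') - f i (x0 - u') = 2 f i u', so one of the two is large. *)
    have [xP|xP] := ltP n.+1%:R (rnorm (f i (x0 + u'))).
      by exists (x0 + u') => //; rewrite addrAC subrr add0r u'r.
    exists (x0 - u'); first by rewrite addrAC subrr add0r rnormN u'r.
    have := rnormD (f i (x0 + u')) (- f i (x0 - u')).
    have -> : f i (x0 + u') - f i (x0 - u') = (2 : R)%:C%C *: f i u'.
      rewrite fD fB opprB [f i x0 + _]addrC addrACA subrr addr0.
      by rewrite rmorphMn /= scaler_nat mulr2n.
    by rewrite rnormZR rnormN ger0_norm //; lra.
  have [C CP] := bf i.
  have C1 : 0 < `|C| + 1 by have := normr_ge0 C; lra.
  (* Radius r / 2 keeps the ball inside the given one, and on a ball of radius
     (|C| + 1)^-1 the map f i varies by at most 1. *)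
  exists (x1, Num.min (r / 2) (Num.min n.+1%:R^-1 (`|C| + 1)^-1)) => _ /=.
  split.
  - by rewrite !lt_min divr_gt0 // !invr_gt0 C1 ltr0n.
  - by rewrite !ge_min lexx orbT.
  - move=> z; rewrite !le_min => /andP[zr _].
    by have := rnorm_triangle x1 z x0; lra.
  - exists i => z; rewrite !le_min => /and3P[_ _ zC].
    have : rnorm (f i (z - x1)) <= 1.
      apply: le_trans (CP _) _.
      apply: (@le_trans _ _ ((`|C| + 1) * rnorm (z - x1))).
        by apply: ler_wpM2r; [exact: rnorm_ge0|have := ler_norm C; lra].
      by rewrite mulrC -ler_pdivlMr // div1r.
    have := rnorm_triangle (f i z) (f i x1) 0.
    rewrite !subr0 rnormB -fB.
    by move: x1P; rewrite -natr1; lra.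
have [next nextP] := choice (fun p : nat * (V * R) => step p.1 p.2).
(* q n is the n-th ball, as a pair of its centre and its radius. *)
pose q := fix q n := if n is n'.+1 then next (n', q n') else (0, 1).
have q0 n : 0 < (q n).2.
  by elim: n => [|n IH] /=; [exact: ltr01|case: (nextP (n, q n) IH)].
have qsub n m z : (n <= m)%N ->
    rnorm (z - (q m).1) <= (q m).2 -> rnorm (z - (q n).1) <= (q n).2.
  elim: m => [|m IH]; first by rewrite leqn0 => /eqP ->.
  rewrite leq_eqVlt => /orP[/eqP -> //|nm] zm; apply: IH => //.
  by have [_ _] := nextP (m, q m) (q0 m); move=> + _; apply.
have [| |l lP] := @cauchy_rnorm_cvg _ (fun n => (q n.+1).1)
    (fun n => (q n.+1).2).
- move=> e /inv_succ_lt[n ne]; exists n; apply: le_lt_trans ne.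
  by case: (nextP (n, q n) (q0 n)).
- move=> n m nm; rewrite rnormB; apply: (@qsub n.+1 m.+1) => //.
  by rewrite subrr rnorm0 ltW.
have [M MP] := pf l.
have M0 : 0 <= `|M| by [].
have := archi_boundP M0; set n := Num.Def.archi_bound _ => Mn.
case: (nextP (n, q n) (q0 n)) => _ _ _ [i /(_ l)].
rewrite rnormB => /(_ (lP n)) /=.
by have := MP i; have := ler_norm M; lra.
Qed.

End RealNorm.

(** * Bounds for sesquilinear forms *)

Section Sesquilinear.
Variables (R : realType) (V W : normedModType R[i]) (s : V -> V -> W).
Hypothesis sDr : forall x y z, s x (y + z) = s x y + s x z.
Hypothesis sZr : forall k x y, s x (k *: y) = k *: s x y.
Hypothesis sDl : forall x y z, s (x + y) z = s x z + s y z.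
Hypothesis sZl : forall k x y, s (k *: x) y = Num.conj k *: s x y.
Hypothesis s_sqr : forall x, rnorm (s x x) = rnorm x ^+ 2.

Let i_ : R[i] := ('i)%C.

Lemma rnormZi (U : normedModType R[i]) (x : U) : rnorm (i_ *: x) = rnorm x.
Proof. by rewrite rnormZ normc_def /= expr0n add0r expr1n sqrtr1 mul1r. Qed.

Lemma polarization x y :
  4%:R *: s x y = s (x + y) (x + y) - s (x - y) (x - y)
    - i_ *: (s (x + i_ *: y) (x + i_ *: y) - s (x - i_ *: y) (x - i_ *: y)).
Proof.
have q a b : s (a + b) (a + b) - s (a - b) (a - b)
    = 2%:R *: (s a b + s b a).
  have sNr u v : s u (- v) = - s u v by rewrite -scaleN1r sZr scaleN1r.
  have sNl u v : s (- u) v = - s u v.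
    by rewrite -scaleN1r sZl rmorphN rmorph1 scaleN1r.
  rewrite !sDl !sDr !sNr !sNl opprK.
  move: (s a a) (s a b) (s b a) (s b b) => p u v w.
  rewrite [- (_ + _)]opprD [LHS]addrACA opprB [p + u]addrC.
  rewrite [X in X + _]addrACA subrr addr0 opprD opprK.
  by rewrite [X in _ + X]addrACA subrr addr0 scaler_nat mulr2n addrACA.
have iE : i_ * i_ = -1 by exact: sqr_i.
have iC : Num.conj i_ = - i_.
  by apply/eqP; rewrite eq_complex /= oppr0 !eqxx.
rewrite !q sZr sZl iC !scalerDr !scalerA.
have -> : i_ * 2 * - i_ = 2 by rewrite mulrAC mulrN iE opprK mul1r.
have -> : i_ * (2 * i_) = - 2 by rewrite mulrCA iE mulrN1.
rewrite scaleNr opprD opprK addrACA subrr addr0 -scalerDl.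
by rewrite -natrD.
Qed.

(** A form that restricts to the squared norm on the diagonal is bounded: the
    polarization identity gives [|s(a, b)| <= (|a| + |b|)^2], and rescaling a
    and b to equal norms gives the stated estimate. *)
Lemma rnorm_sesquilinear x y : rnorm (s x y) <= 4 * rnorm x * rnorm y.
Proof.
have quad a b : rnorm (s a b) <= (rnorm a + rnorm b) ^+ 2.
  have d c d : rnorm d = rnorm b -> c = a + d ->
    rnorm (s c c) <= (rnorm a + rnorm b) ^+ 2.
    move=> <- ->; rewrite s_sqr lerXn2r ?nnegrE ?addr_ge0 ?rnorm_ge0 //.
    exact: rnormD.
  have: rnorm (4%:R *: s a b) <= 4 * (rnorm a + rnorm b) ^+ 2.
    rewrite polarization.
    have n1 := d _ b erefl erefl.
    have n2 := d _ (- b) (rnormN b) erefl.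
    have n3 := d _ (i_ *: b) (rnormZi b) erefl.
    have n4 := d _ (- (i_ *: b)) (etrans (rnormN _) (rnormZi b)) erefl.
    apply: le_trans (rnormD _ _) _; rewrite rnormN rnormZi.
    have := rnormD (s (a + b) (a + b)) (- s (a - b) (a - b)).
    have := rnormD (s (a + i_ *: b) (a + i_ *: b))
                   (- s (a - i_ *: b) (a - i_ *: b)).
    rewrite !rnormN => h1 h2; lra.
  have -> : (4%:R : R[i]) = ((4%:R : R)%:C)%C by rewrite rmorph_nat.
  by rewrite rnormZR ger0_norm //; lra.
have [x0|x0] := eqVneq (rnorm x) 0.
  rewrite (rnorm_eq0 x0).
  have -> : s 0 y = 0 by rewrite -(scale0r 0) sZl rmorph0 !scale0r.
  by rewrite !rnorm0 mulr0 mul0r.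
have [y0|y0] := eqVneq (rnorm y) 0.
  rewrite (rnorm_eq0 y0).
  have -> : s x 0 = 0 by rewrite -(scale0r 0) sZr scale0r.
  by rewrite !rnorm0 mulr0.
have {}x0 : 0 < rnorm x by rewrite lt_neqAle eq_sym x0 rnorm_ge0.
have {}y0 : 0 < rnorm y by rewrite lt_neqAle eq_sym y0 rnorm_ge0.
have := quad (((rnorm y)%:C)%C *: x) (((rnorm x)%:C)%C *: y).
have -> : s ((rnorm y)%:C%C *: x) ((rnorm x)%:C%C *: y)
    = (rnorm x)%:C%C *: ((rnorm y)%:C%C *: s x y).
  by rewrite sZr sZl; congr (_ *: (_ *: _)); exact: conjc_real.
rewrite !rnormZR !ger0_norm ?rnorm_ge0 // => h.
rewrite -(ler_pM2l (mulr_gt0 x0 y0)) -mulrA; apply: le_trans h _.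
by move: (rnorm x) (rnorm y) => a b; lra.
Qed.

End Sesquilinear.

(** * C*-algebras, multipliers and Hilbert modules *)

Section CStarAlgebras.
Variables (R : realType) (A : cstarAlgType R).
Implicit Types a b c : A.

Lemma rnorm_amul a b : rnorm (amul a b) <= rnorm a * rnorm b.
Proof. by rewrite -lecR rmorphM /= -!rnormE norm_amul. Qed.

Lemma rnorm_astar_amul a : rnorm (amul (astar a) a) = rnorm a ^+ 2.
Proof. by apply: complexI; rewrite rmorphXn /= -!rnormE norm_astar_amul. Qed.

Lemma rnorm_astar a : rnorm (astar a) = rnorm a.
Proof.
suff le b : rnorm b <= rnorm (astar b).
  by apply/eqP; rewrite eq_le le andbT -{2}(astarK a) le.
have [->|b0] := eqVneq (rnorm b) 0; first exact: rnorm_ge0.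
have {}b0 : 0 < rnorm b by rewrite lt_neqAle eq_sym b0 rnorm_ge0.
by rewrite -(ler_pM2r b0) -expr2 -rnorm_astar_amul rnorm_amul.
Qed.

Lemma linear_amull b : linear (fun a => amul a b).
Proof. by move=> k x y /=; rewrite amulDl amulZl. Qed.

Lemma linear_amulr a : linear (amul a).
Proof. by move=> k x y /=; rewrite amulDr amulZr. Qed.

Lemma amulr0 a : amul a 0 = 0. Proof. exact: linear_map0 (linear_amulr a). Qed.

Lemma amul0r a : amul 0 a = 0. Proof. exact: linear_map0 (linear_amull a). Qed.

Lemma amulBl a b c : amul (a - b) c = amul a c - amul b c.
Proof. exact: linear_mapB (linear_amull c) a b. Qed.

Lemma astar0 : astar 0 = 0 :> A.
Proof. by have := astarZ (0 : R[i]) (0 : A); rewrite rmorph0 !scale0r. Qed.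

Lemma astar_amul_eq0 a : amul (astar a) a = 0 -> a = 0.
Proof. exact: regular_rip_eq0. Qed.

(** A C*-algebra acts faithfully on itself: take [a] to be the adjoint of c. *)
Lemma amul_eq0l c : (forall a, amul c a = 0) -> c = 0.
Proof.
move=> c0; rewrite -(astarK c) (@astar_amul_eq0 (astar c)) ?astar0 //.
by rewrite astarK.
Qed.

Lemma adjoint_op_ract (E F : rightPreHilbertType A) (T : adjoint_op E F) x a :
  T (ract x a) = ract (T x) a.
Proof.
have T' := is_adjointC (adjP T).
by apply: rip_inj => z; rewrite -T' rip_ract T' -rip_ract.
Qed.

Lemma multiplier_amul (m : multiplier A) a b :
  m (amul a b) = amul (m a : A) b.
Proof. exact: (adjoint_op_ract m). Qed.

Lemma multiplier_linear (m : multiplier A) : linear (m : A -> A).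
Proof. by move=> k x y /=; rewrite adjoint_opD adjoint_opZ. Qed.

(** A map with an adjoint is automatically bounded.  The maps
    [b |-> (m a)^* b / |a|], indexed by a, are bounded, and pointwise bounded
    because they equal [b |-> a^* (m^* b) / |a|]; evaluating the uniform bound
    at [b = m a] gives the claim.  For [a = 0] the factor is 0 by the
    convention for inverses. *)
Lemma multiplier_bounded (m : multiplier A) :
  exists C, forall a, rnorm (m a : A) <= C * rnorm a.
Proof.
pose f a b := ((rnorm a)^-1%:C)%C *: amul (astar (m a : A)) b.
have fE a b :
    f a b = ((rnorm a)^-1%:C)%C *: amul (astar a) (adj m b : A).
  by congr (_ *: _); exact: (adjP m).
have nf a x : rnorm (((rnorm a)^-1%:C)%C *: x) = (rnorm a)^-1 * rnorm x.
  by rewrite rnormZR ger0_norm ?invr_ge0 ?rnorm_ge0.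
have [a k x y /=|a|b|C CP] := @uniform_boundedness _ A A A f.
- by rewrite /f amulDr amulZr scalerDr !scalerA mulrC.
- exists ((rnorm a)^-1 * rnorm (m a : A)) => b.
  rewrite nf -mulrA ler_wpM2l ?invr_ge0 ?rnorm_ge0 //.
  by rewrite -(rnorm_astar (m a : A)) rnorm_amul.
- exists (rnorm (adj m b : A)) => a; rewrite fE nf.
  have [->|a0] := eqVneq (rnorm a) 0.
    by rewrite invr0 mul0r rnorm_ge0.
  have {}a0 : 0 < rnorm a by rewrite lt_neqAle eq_sym a0 rnorm_ge0.
  rewrite mulrC ler_pdivrMr // mulrC -(rnorm_astar a); exact: rnorm_amul.
exists C => a.
have [a0|a0] := eqVneq (rnorm a) 0.
  by rewrite (rnorm_eq0 a0) (linear_map0 (multiplier_linear m)) rnorm0 mulr0.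
have {}a0 : 0 < rnorm a by rewrite lt_neqAle eq_sym a0 rnorm_ge0.
have [->|b0] := eqVneq (m a : A) 0.
  rewrite rnorm0.
  have := CP a a; have := rnorm_ge0 (f a a) => h1 h2; exact: le_trans h1 h2.
have {}b0 : 0 < rnorm (m a : A).
  rewrite lt_neqAle rnorm_ge0 andbT eq_sym.
  by apply: contra b0 => /eqP/rnorm_eq0 ->.
have := CP a (m a : A); rewrite nf rnorm_astar_amul expr2 mulrA ler_pM2r //.
by rewrite mulrC ler_pdivrMr.
Qed.

End CStarAlgebras.

Section HilbertModules.
Variables (R : realType) (A : cstarAlgType R).

Section Right.
Variable X : rightHilbertType A.
Implicit Types (x y : X) (a : A).

Lemma linear_ractl a : linear (fun x => ract x a).
Proof. by move=> k y z /=; rewrite ractDl ractZl. Qed.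

Lemma linear_ractr x : linear (ract x : A -> X).
Proof. by move=> k y z /=; rewrite ractDr ractZr. Qed.

Lemma rnorm_rip_sqr x : rnorm (rip x x : A) = rnorm x ^+ 2.
Proof. by apply: complexI; rewrite rmorphXn /= -!rnormE norm_rip. Qed.

(** A weak Cauchy-Schwarz inequality, enough for continuity. *)
Lemma rnorm_rip x y : rnorm (rip x y : A) <= 4 * rnorm x * rnorm y.
Proof.
apply: (rnorm_sesquilinear (s := fun x y => rip x y : A)) => //.
- exact: ripDr.
- exact: ripZr.
- exact: ripDl.
- exact: ripZl.
- exact: rnorm_rip_sqr.
Qed.

Lemma ract_ripl x y a : rip (ract x a) y = amul (astar a) (rip x y) :> A.
Proof. by rewrite rip_star rip_ract astarM -rip_star. Qed.

Lemma rnorm_ract x a : rnorm (ract x a) <= rnorm x * rnorm a.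
Proof.
rewrite -(@ler_pXn2r _ 2) ?nnegrE ?mulr_ge0 ?rnorm_ge0 //.
rewrite -rnorm_rip_sqr rip_ract ract_ripl; apply: le_trans (rnorm_amul _ _) _.
rewrite exprMn expr2 mulrA ler_wpM2r ?rnorm_ge0 //.
apply: le_trans (rnorm_amul _ _) _; rewrite rnorm_rip_sqr rnorm_astar mulrC.
exact: lexx.
Qed.

Lemma ract_eq0 x : (forall a, ract x a = 0) -> x = 0.
Proof.
move=> x0; apply: (@rip_eq0 R A); apply: amul_eq0l => a.
by rewrite -rip_ract x0; exact: rip0r.
Qed.

End Right.

Section Left.
Variable X : leftHilbertType A.
Implicit Types (x y : X) (a : A).

Lemma lipDr x y z : lip x (y + z) = lip x y + lip x z :> A.
Proof. by rewrite lip_star lipDl astarD -!lip_star. Qed.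

Lemma lipZr k x y : lip x (k *: y) = Num.conj k *: lip x y :> A.
Proof. by rewrite lip_star lipZl astarZ -lip_star. Qed.

Lemma linear_lip y : linear (fun x => lip x y : A).
Proof. by move=> k x z /=; rewrite lipDl lipZl. Qed.

Lemma linear_lactl x : linear (fun a => lact a x).
Proof. by move=> k y z /=; rewrite lactDl lactZl. Qed.

Lemma rnorm_lip_sqr x : rnorm (lip x x : A) = rnorm x ^+ 2.
Proof. by apply: complexI; rewrite rmorphXn /= -!rnormE norm_lip. Qed.

Lemma rnorm_lip x y : rnorm (lip x y : A) <= 4 * rnorm x * rnorm y.
Proof.
rewrite mulrAC; apply: (rnorm_sesquilinear (s := fun x y => lip y x : A)) => //.
- by move=> u v w; exact: lipDl.
- by move=> u v w; exact: lipZl.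
- by move=> u v w; exact: lipDr.
- by move=> u v w; exact: lipZr.
- exact: rnorm_lip_sqr.
Qed.

Lemma lip_lactr x y a : lip x (lact a y) = amul (lip x y) (astar a) :> A.
Proof. by rewrite lip_star lip_lact astarM -lip_star. Qed.

Lemma rnorm_lact a x : rnorm (lact a x) <= rnorm a * rnorm x.
Proof.
rewrite -(@ler_pXn2r _ 2) ?nnegrE ?mulr_ge0 ?rnorm_ge0 //.
rewrite -rnorm_lip_sqr lip_lact lip_lactr; apply: le_trans (rnorm_amul _ _) _.
rewrite exprMn [in leRHS]expr2 -mulrA ler_wpM2l ?rnorm_ge0 //.
apply: le_trans (rnorm_amul _ _) _; rewrite rnorm_lip_sqr rnorm_astar mulrC.
exact: lexx.
Qed.

Lemma lip_inj x y : (forall z, lip x z = lip y z :> A) -> x = y.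
Proof.
move=> xy; apply/subr0_eq/(@lip_eq0 R A).
by rewrite (linear_mapB (linear_lip _)) xy subrr.
Qed.

End Left.

End HilbertModules.

(** * Full bimodules and the extension of the left action to M(A) *)

Section FullBimodule.
Variables (R : realType) (A : cstarAlgType R) (X : hilbertBimodType A).
Hypothesis fullX : full_bimod X.

Lemma full_lip_ind (P : set A) : closed_subspace P ->
  (forall x y : X, P (lip x y)) -> forall a, P a.
Proof.
move=> cP PX a; have : [set: A] a by [].
case: fullX => <- _; apply: (closed_span_min cP) => _ [x [y ->]].
exact: PX.
Qed.

Lemma full_rip_ind (P : set A) : closed_subspace P ->
  (forall x y : X, P (rip x y)) -> forall a, P a.
Proof.
move=> cP PX a; have : [set: A] a by [].
case: fullX => _ <-; apply: (closed_span_min cP) => _ [x [y ->]].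
exact: PX.
Qed.

Lemma lact_ind (P : set X) : closed_subspace P ->
  (forall a x, P (lact a x)) -> forall x, P x.
Proof.
move=> cP PX x; have : [set: X] x by [].
rewrite -(@lact_nondegenerate R A X).
by apply: (closed_span_min cP) => _ [a [y ->]]; exact: PX.
Qed.

Lemma ract_ind (P : set X) : closed_subspace P ->
  (forall x a, P (ract x a)) -> forall x, P x.
Proof.
move=> cP PX x; have : [set: X] x by [].
rewrite -(@ract_nondegenerate R A X).
by apply: (closed_span_min cP) => _ [y [a ->]]; exact: PX.
Qed.

Lemma lact_eq0 a : (forall x : X, lact a x = 0) -> a = 0.
Proof.
move=> a0; apply: amul_eq0l => b.
apply: (@full_lip_ind [set b | amul a b = 0] _ _ b).
  apply: (closed_subspace_preim (linear_amulr a) _ (closed_subspace0 A)).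
  exact: rnorm_amul.
by move=> x y /=; rewrite -lip_lact a0 (linear_map0 (linear_lip y)).
Qed.

(** The graph of the operator on X induced by a multiplier m.  By
    non-degeneracy of the left inner product, y is determined by x. *)
Definition phi_graph (m : multiplier A) (x y : X) : Prop :=
  forall z, lip y z = m (lip x z) :> A.

Lemma phi_graph_lact m a x : phi_graph m (lact a x) (lact (m a : A) x).
Proof. by move=> z; rewrite !lip_lact multiplier_amul. Qed.

Lemma phi_graph_bounded m :
  exists2 C, 0 <= C & forall x y, phi_graph m x y -> rnorm y <= C * rnorm x.
Proof.
have [C CP] := multiplier_bounded m.
have C0 : 0 <= `|C| * 4 by rewrite mulr_ge0.
exists (`|C| * 4) => // x y xy.
have [y0|y0] := eqVneq (rnorm y) 0; first by rewrite y0 mulr_ge0 ?rnorm_ge0.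
have {}y0 : 0 < rnorm y by rewrite lt_neqAle eq_sym y0 rnorm_ge0.
rewrite -(ler_pM2r y0) -expr2 -rnorm_lip_sqr xy.
apply: le_trans (CP _) _.
apply: (@le_trans _ _ (`|C| * rnorm (lip x y : A))).
  by rewrite ler_wpM2r ?rnorm_ge0 // ler_norm.
by rewrite -!mulrA ler_wpM2l // mulrA rnorm_lip.
Qed.

Lemma phi_graph_total m x : exists y, phi_graph m x y.
Proof.
have [C C0 CP] := phi_graph_bounded m.
have [D DP] := multiplier_bounded m.
apply: (@lact_ind [set x | exists y, phi_graph m x y]); last first.
  by move=> a y; exists (lact (m a : A) y); exact: phi_graph_lact.
have lm := multiplier_linear m.
apply: (closed_subspace_dom (C := C)) => //.
- by move=> z; rewrite !(linear_map0 (linear_lip z)) (linear_map0 lm).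
- move=> k v w v' w' vw vw' z.
  rewrite (linear_lip z) vw vw' -(linear_mapZ lm) -(linear_mapD lm).
  by rewrite -lipZl -lipDl.
- move=> v w vw z; apply/subr0_eq/rnorm_eq0/eqP.
  rewrite eq_le rnorm_ge0 andbT.
  apply: (@le_eps _ _ _ (4 * rnorm z + `|D| * (4 * rnorm z))).
    by rewrite addr_ge0 ?mulr_ge0 ?rnorm_ge0.
  move=> e e0; rewrite add0r; have [v' [w' [vw' ve we]]] := vw e e0.
  have -> : (lip w z - m (lip v z) : A) = lip (w - w') z - m (lip (v - v') z).
    rewrite !(linear_mapB (linear_lip z)) (linear_mapB lm) vw' opprB addrA.
    by rewrite subrK.
  apply: le_trans (rnormD _ _) _; rewrite rnormN mulrDl lerD //.
    apply: le_trans (rnorm_lip _ _) _; rewrite mulrAC.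
    by rewrite ler_wpM2l ?mulr_ge0 ?rnorm_ge0 // ltW.
  have Dle := ler_norm D.
  apply: le_trans (DP _) _.
  apply: (@le_trans _ _ (`|D| * rnorm (lip (v - v') z : A))).
    by rewrite ler_wpM2r ?rnorm_ge0.
  rewrite -mulrA ler_wpM2l //; apply: le_trans (rnorm_lip _ _) _.
  by rewrite mulrAC ler_wpM2l ?mulr_ge0 ?rnorm_ge0 // ltW.
Qed.

Lemma ract_eq0r a : (forall x : X, ract x a = 0) -> a = 0.
Proof.
move=> a0; apply: astar_amul_eq0.
apply: (@full_rip_ind [set b | amul b a = 0] _ _ (astar a)).
  apply: (closed_subspace_preim (linear_amull a) (C := rnorm a) _
    (closed_subspace0 A)) => b.
  by rewrite mulrC rnorm_amul.
by move=> x y /=; rewrite -rip_ract a0; exact: rip0r.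
Qed.

(** The operators induced by m and by its adjoint are adjoint to each other.
    The right action being faithful, it is enough to compare the products
    [z rip(y, x')] and [z rip(x, y')], which the bimodule identity turns into
    left actions, hence into an identity between elements of A. *)
Lemma phi_graph_adjoint m x y x' y' :
  phi_graph m x y -> phi_graph (adj m) x' y' -> rip y x' = rip x y' :> A.
Proof.
move=> xy xy'; apply/subr0_eq/ract_eq0r => z.
rewrite (linear_mapB (linear_ractr z)) -!lact_lip.
apply/eqP; rewrite subr_eq0; apply/eqP/lip_inj => w.
rewrite !lip_lact xy' (lip_star y z) xy (lip_star x z).
exact: (adjP m).
Qed.

(** Adjointable operators need not be known to be continuous here: the inner
    products [rip z (T x) = rip (T^* z) x] are continuous in x. *)
Lemma adjoint_op_lact_ext (S T : adjoint_op X X) :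
  (forall a x, S (lact a x) = T (lact a x)) -> S = T.
Proof.
move=> ST; apply: adjoint_opP => x; apply: rip_inj => z.
move: x; apply: lact_ind => [|a x] /=; last by rewrite ST.
have bnd (U : adjoint_op X X) x :
    rnorm (rip z (U x) : A) <= 4 * rnorm (adj U z) * rnorm x.
  by rewrite -(is_adjointC (adjP U)) rnorm_rip.
have lin (U : adjoint_op X X) : linear (fun x => rip z (U x) : A).
  by move=> k x y /=; rewrite adjoint_opD adjoint_opZ ripDr ripZr.
exact: (closed_subspace_eq (lin S) (lin T) (bnd S) (bnd T)).
Qed.

Lemma phi_bar_unique (m : multiplier A) (T : adjoint_op X X) :
  (forall a x, T (lact a x) = lact (m a : A) x) -> phi_bar X m = T.
Proof.
move=> Tm; rewrite /phi_bar; case: xgetP => [_ -> /= phim|/(_ T)/(_ Tm) //].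
by apply: adjoint_op_lact_ext => a x; rewrite phim Tm.
Qed.

(** In particular every multiplier has an extension to X, so that the default
    value in the definition of [phi_bar] is never taken. *)
Lemma phi_bar_lip (m : multiplier A) x y :
  lip (phi_bar X m x) y = m (lip x y) :> A.
Proof.
have [T TP] := choice (phi_graph_total m).
have [T' TP'] := choice (phi_graph_total (adj m)).
have TT' : is_adjoint T T'.
  by move=> u v; exact: phi_graph_adjoint (TP u) (TP' v).
rewrite (@phi_bar_unique m (mk_adjoint_op TT')); first exact: TP.
by move=> a z; apply: lip_inj => w; rewrite TP; exact/esym/phi_graph_lact.
Qed.

Lemma phi_bar_lact (m : multiplier A) a x :
  phi_bar X m (lact a x) = lact (m a : A) x.
Proof.
by apply: lip_inj => y; rewrite phi_bar_lip (phi_graph_lact m a x y).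
Qed.

Lemma phi_bar_inj : injective (phi_bar X).
Proof.
move=> m m' mm'; apply: adjoint_opP => a; apply/subr0_eq/lact_eq0 => x.
by rewrite (linear_mapB (linear_lactl x)) -!phi_bar_lact mm' subrr.
Qed.

Lemma phi_barK (m : multiplier A) : phi_bar_inv (phi_bar X m) = m.
Proof.
rewrite /phi_bar_inv; case: xgetP => [m' -> /= /phi_bar_inj //|/(_ m) /=].
by [].
Qed.

End FullBimodule.

(** * Extensions and the morphism into the multiplier bimodule *)

Section Extension.
Variables (R : realType) (A B : cstarAlgType R).
Variables (X : hilbertBimodType A) (Y : hilbertBimodType B).
Variable psi : (X -> Y) * (A -> B).
Hypothesis fullX : full_bimod X.
Hypothesis ext : is_extension psi.

Let psiX := psi.1.
Let psiA := psi.2.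

Let psiX_linear : linear psiX. Proof. by case: ext => [[[]]]. Qed.
Let psiA_linear : linear psiA. Proof. by case: ext => [[[_ []]]]. Qed.
Let psiAM a b : psiA (amul a b) = amul (psiA a) (psiA b).
Proof. by case: ext => [[[_ []]]]. Qed.
Let psiA_star a : psiA (astar a) = astar (psiA a).
Proof. by case: ext => [[[_ []]]]. Qed.
Let psiX_ract x a : psiX (ract x a) = ract (psiX x) (psiA a).
Proof. by case: ext => [[]]. Qed.
Let psiX_lact a x : psiX (lact a x) = lact (psiA a) (psiX x).
Proof. by case: ext => [[]]. Qed.
Let psiA_rip x y : psiA (rip x y) = rip (psiX x) (psiX y).
Proof. by case: ext => [[]]. Qed.
Let psiA_lip x y : psiA (lip x y) = lip (psiX x) (psiX y).
Proof. by case: ext => [[]]. Qed.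

Let rnorm_psiA a : rnorm (psiA a) = rnorm a.
Proof. by case: ext => _ + _ _; rewrite /rnorm => ->. Qed.

Let psiA_inj : injective psiA.
Proof.
move=> a b ab; apply/subr0_eq/rnorm_eq0.
by rewrite -rnorm_psiA (linear_mapB psiA_linear) ab subrr rnorm0.
Qed.

Let rnorm_psiX x : rnorm (psiX x) = rnorm x.
Proof.
apply/eqP; rewrite -(@eqrXn2 _ 2) ?rnorm_ge0 // -!rnorm_rip_sqr -psiA_rip.
by rewrite rnorm_psiA.
Qed.

Let psiX_inj : injective psiX.
Proof.
move=> a b ab; apply/subr0_eq/rnorm_eq0.
by rewrite -rnorm_psiX (linear_mapB psiX_linear) ab subrr rnorm0.
Qed.

Let closed_range_psiA : closed_subspace (range psiA).
Proof. by case: ext => _ _ [cI I0 ID _] _; split. Qed.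

Lemma closed_range_psiX : closed_subspace [set y | exists x, y = psiX x].
Proof.
apply: (closed_subspace_dom (G := fun y x => y = psiX x) (C := 1)).
- by rewrite (linear_map0 psiX_linear).
- by move=> k y x y' x' -> ->; rewrite psiX_linear.
- by move=> y x ->; rewrite mul1r rnorm_psiX.
- move=> y x yx; apply/subr0_eq/rnorm_eq0/eqP; rewrite eq_le rnorm_ge0 andbT.
  apply: (@le_eps _ _ _ 2) => // e e0; rewrite add0r.
  have [_ [x' [-> yx' xx']]] := yx e e0.
  have := rnorm_triangle (psiX x') y (psiX x).
  by rewrite -(linear_mapB psiX_linear) rnorm_psiX rnormB (rnormB x'); lra.
Qed.

Lemma extension_amul b a : exists c, psiA c = amul b (psiA a).
Proof.
have [_ _ [_ _ _ idI] _] := ext.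
have [|_ [c _ cE]] := idI (psiA a) b; first by exists a.
by exists c.
Qed.

(** Inner products with elements of psi_X(X) lie in psi_A(A); clear for the
    products [psi_X(u) psi_A(a)], as psi_A(A) is an ideal. *)
Lemma extension_rip (y : Y) (x : X) : exists a, psiA a = rip y (psiX x).
Proof.
suff [a _ <-] : range psiA (rip y (psiX x)) by exists a.
apply: (@ract_ind _ _ _ [set x | range psiA (rip y (psiX x))]).
  apply: (closed_subspace_preim (C := 4 * rnorm y) _ _ closed_range_psiA).
    by move=> k u v /=; rewrite psiX_linear ripDr ripZr.
  by move=> u; rewrite -(rnorm_psiX u) rnorm_rip.
move=> u a /=; rewrite psiX_ract rip_ract.
by have [c <-] := extension_amul (rip y (psiX u)) a; exists c.
Qed.

Lemma extension_lact (a : A) (y : Y) : exists x, lact (psiA a) y = psiX x.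
Proof.
apply: (full_lip_ind fullX (P := [set a | exists x, lact (psiA a) y = psiX x])).
  apply: (closed_subspace_preim (C := rnorm y) _ _ closed_range_psiX).
    by move=> k u v /=; rewrite psiA_linear lactDl lactZl.
  by move=> u; rewrite -(rnorm_psiA u) mulrC rnorm_lact.
move=> u v; have [c cE] := extension_rip y v.
exists (ract u (astar c)).
by rewrite psiA_lip lact_lip psiX_ract psiA_star cE -rip_star.
Qed.

(** Invariance of psi_A(A) turns [extension_lact] into its right-handed
    counterpart. *)
Lemma extension_ract (y : Y) (a : A) : exists x, psiX x = ract y (psiA a).
Proof.
suff [x ->] : [set z | exists x, z = psiX x] (ract y (psiA a)) by exists x.
case: ext => _ _ _ [_ inv].
have : ideal_ract Y (range psiA) (ract y (psiA a)).
  by apply: sub_closed_span; exists y, (psiA a); split => //; exists a.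
rewrite -inv; apply: (closed_span_min closed_range_psiX).
by move=> _ [_ [z [[c _ <-] ->]]]; exact: extension_lact.
Qed.

(** The two actions on Y commute, at least for elements of psi_A(A), which are
    limits of combinations of inner products [rip (psi_X u) (psi_X v)]. *)
Lemma extension_lact_ract (b : B) (y : Y) (a : A) :
  lact b (ract y (psiA a)) = ract (lact b y) (psiA a).
Proof.
pose P := [set a | lact b (ract y (psiA a)) = ract (lact b y) (psiA a)].
apply: (full_rip_ind fullX (P := P)).
  apply: (closed_subspace_eq (C := rnorm b * rnorm y) (D := rnorm (lact b y))).
  - by move=> k u v /=; rewrite psiA_linear ractDr ractZr lactDr lactZr.
  - by move=> k u v /=; rewrite psiA_linear ractDr ractZr.
  - move=> u; apply: le_trans (rnorm_lact _ _) _.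
    by rewrite -mulrA ler_wpM2l ?rnorm_ge0 // -(rnorm_psiA u) rnorm_ract.
  - by move=> u; rewrite -(rnorm_psiA u) rnorm_ract.
by move=> u v; rewrite /P /= psiA_rip -!lact_lip lip_lact lactA.
Qed.

(** The maps [a |-> psi_A^-1 (b psi_A(a))], [a |-> psi_X^-1 (y psi_A(a))] and
    [x |-> psi_A^-1 rip(y, psi_X x)], where the inverse images are chosen; they
    are unique since psi_A and psi_X are injective. *)
Definition lamA_fun (b : B) (a : A) : A := sval (cid (extension_amul b a)).

Lemma lamA_funE b a : psiA (lamA_fun b a) = amul b (psiA a).
Proof. by rewrite /lamA_fun; case: cid. Qed.

Definition lamX_fun (y : Y) (a : A) : X := sval (cid (extension_ract y a)).

Lemma lamX_funE y a : psiX (lamX_fun y a) = ract y (psiA a).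
Proof. by rewrite /lamX_fun; case: cid. Qed.

Definition lamX_adj_fun (y : Y) (x : X) : A := sval (cid (extension_rip y x)).

Lemma lamX_adj_funE y x : psiA (lamX_adj_fun y x) = rip y (psiX x).
Proof. by rewrite /lamX_adj_fun; case: cid. Qed.

Lemma lamA_adjoint b :
  @is_adjoint R A (regular_mod A) (regular_mod A)
    (lamA_fun b) (lamA_fun (astar b)).
Proof.
move=> c d; apply: psiA_inj; rewrite /rip /= !psiAM !psiA_star !lamA_funE.
by rewrite astarM amulA.
Qed.

Lemma lamX_adjoint y :
  @is_adjoint R A (regular_mod A) X (lamX_fun y) (lamX_adj_fun y).
Proof.
move=> c x; apply: psiA_inj.
rewrite -[RHS]/(psiA (amul (astar c) (lamX_adj_fun y x))).
by rewrite psiA_rip lamX_funE ract_ripl psiAM psiA_star lamX_adj_funE.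
Qed.

(** The components lambda_B and lambda_Y of the morphism from (Y, B) to
    (M(X), M(A)). *)
Definition lamA (b : B) : multiplier A := mk_adjoint_op (lamA_adjoint b).
Definition lamX (y : Y) : mult_bimod X := mk_adjoint_op (lamX_adjoint y).
Definition lam := (lamX, lamA).

Lemma lamAE b a : psiA (lamA b a) = amul b (psiA a).
Proof. exact: lamA_funE. Qed.

Lemma lamXE y a : psiX (lamX y a) = ract y (psiA a).
Proof. exact: lamX_funE. Qed.

Lemma lamX_adjE y x : psiA (adj (lamX y) x) = rip y (psiX x).
Proof.
rewrite (is_adjoint_unique (S := mk_adjoint_op (is_adjointC (lamX_adjoint y)))).
  exact: lamX_adj_funE.
exact: lamX_adjoint.
Qed.

Lemma lam_morphism : bimod_morphism lam.
Proof.
split => /=.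
- split; last split.
  + move=> k y z /=; apply: adjoint_opP => a; apply: psiX_inj.
    rewrite lamXE -[RHS]/(psiX (k *: lamX y a + lamX z a)).
    by rewrite psiX_linear !lamXE ractDl ractZl.
  + move=> k b c /=; apply: adjoint_opP => a; apply: psiA_inj.
    rewrite lamAE -[RHS]/(psiA (k *: (lamA b a : A) + (lamA c a : A))).
    by rewrite psiA_linear !lamAE amulDl amulZl.
  + move=> b c; apply: adjoint_opP => a; apply: psiA_inj.
    by rewrite lamAE -[RHS]/(psiA (lamA b (lamA c a))) !lamAE amulA.
  + by move=> b; apply/esym/is_adjoint_unique/lamA_adjoint.
- move=> y b; apply: adjoint_opP => a; apply: psiX_inj.
  by rewrite lamXE -[RHS]/(psiX (lamX y (lamA b a))) lamXE lamAE ractA.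
- move=> b y; apply: adjoint_opP => a; apply: psiX_inj.
  rewrite lamXE -[RHS]/(psiX (phi_bar X (lamA b) (lamX y a))).
  rewrite -extension_lact_ract -lamXE.
  (* The vector b psi_X(lamX y a) = (b y) psi_A(a) is of the form psi_X(x), so
     the comparison with phi_bar takes place inside X. *)
  have [x xE] := extension_ract (lact b y) a.
  rewrite -extension_lact_ract -lamXE in xE; rewrite -xE; congr psiX.
  apply: lip_inj => z; rewrite (phi_bar_lip fullX); apply: psiA_inj.
  by rewrite psiA_lip xE lip_lact -psiA_lip lamAE.
- move=> y z; apply: adjoint_opP => a; apply: psiA_inj.
  rewrite lamAE -[RHS]/(psiA (adj (lamX y) (lamX z a))).
  by rewrite lamX_adjE lamXE rip_ract.
- move=> y z; rewrite -[LHS](phi_barK fullX).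
  rewrite -[RHS]/(phi_bar_inv (adj_comp (lamX y) (adj (lamX z)))).
  congr phi_bar_inv; apply: phi_bar_unique => a x; apply: psiX_inj.
  rewrite -[LHS]/(psiX (lamX y (adj (lamX z) (lact a x)))).
  by rewrite lamXE lamX_adjE !psiX_lact lamAE lactA lact_lip.
Qed.

Lemma lam_comp : bimod_comp lam psi = iota_bimod X.
Proof.
rewrite /bimod_comp /iota_bimod; congr pair; apply/funext => z /=.
- apply: adjoint_opP => a; apply: psiX_inj.
  by rewrite lamXE -psiX_ract.
- apply: adjoint_opP => a; apply: psiA_inj.
  by rewrite lamAE -psiAM.
Qed.

Section Unique.
Variable mu : (Y -> mult_bimod X) * (B -> multiplier A).
Hypothesis mu_morphism : bimod_morphism mu.
Hypothesis mu_comp : bimod_comp mu psi = iota_bimod X.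

Lemma morphism_algE b a : psiA (mu.2 b a) = amul b (psiA a).
Proof.
have [c cE] := extension_amul b a; rewrite -cE; congr psiA.
apply/subr0_eq/amul_eq0l => d; rewrite amulBl.
have muI e : mu.2 (psiA e) = iota_alg e.
  by rewrite -[RHS]/((iota_bimod X).2 e) -mu_comp.
case: mu_morphism => [[_ [_ muM _]]] _ _ _ _.
apply/eqP; rewrite subr_eq0 -multiplier_amul; apply/eqP.
by rewrite -[RHS]/(iota_alg c d : A) -muI cE muM muI.
Qed.

Lemma morphism_modE y a : psiX (mu.1 y a) = ract y (psiA a).
Proof.
have [x xE] := extension_ract y a; rewrite -xE; congr psiX.
apply/subr0_eq/ract_eq0 => d; rewrite (linear_mapB (linear_ractl d)).
have muI e : mu.2 (psiA e) = iota_alg e.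
  by rewrite -[RHS]/((iota_bimod X).2 e) -mu_comp.
have muJ e : mu.1 (psiX e) = iota_mod e.
  by rewrite -[RHS]/((iota_bimod X).1 e) -mu_comp.
case: mu_morphism => _ muR _ _ _.
apply/eqP; rewrite subr_eq0 -(adjoint_op_ract (mu.1 y)); apply/eqP.
by rewrite -[RHS]/(iota_mod x d) -muJ xE muR muI.
Qed.

Lemma morphism_unique : mu = lam.
Proof.
rewrite (surjective_pairing mu) /lam; congr pair; apply/funext => z.
- by apply: adjoint_opP => a; apply: psiX_inj; rewrite morphism_modE lamXE.
- by apply: adjoint_opP => a; apply: psiA_inj; rewrite morphism_algE lamAE.
Qed.

Lemma injective_essential :
  injective_morphism mu <-> is_essential_extension psi.
Proof.
have idI : is_ideal (range psiA) by case: ext.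
split=> [muinj|[_ [_ ess]]].
  split => //; split => // J idJ /eqP J0; apply/eqP => IJ; apply: J0.
  have [_ J00 _ JM] := idJ.
  apply/seteqP; split => [b Jb|_ -> //] /=; apply: muinj.
  apply: adjoint_opP => a; apply: psiA_inj.
  rewrite !morphism_algE amul0r.
  (* J psi_A(A) is contained in both ideals, hence vanishes. *)
  have : (range psiA `&` J) (amul b (psiA a)).
    split; last by case: (JM b (psiA a) Jb).
    by have [c <-] := extension_amul b a; exists c.
  by rewrite IJ.
move=> b c bc.
(* The annihilator of psi_A(A), which is the kernel of lambda_B. *)
pose J := [set b | forall a, amul b (psiA a) = 0].
have idJ : is_ideal J.
  have [cJ J0 JD] : closed_subspace J.
    apply: closed_subspace_forall => a.
    apply: (closed_subspace_preim (linear_amull (psiA a))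
      (C := rnorm (psiA a)) _ (closed_subspace0 B)).
    by move=> x; rewrite mulrC rnorm_amul.
  split => // d e Jd; split => a.
    by rewrite -amulA; have [f <-] := extension_amul e a; exact: Jd.
  by rewrite -amulA Jd amulr0.
have [JE|J0] := eqVneq J [set 0].
  apply/subr0_eq; suff : J (b - c) by rewrite JE.
  by move=> a; rewrite amulBl -!morphism_algE bc subrr.
have /eqP[] := ess J idJ J0.
apply/seteqP; split => [_ [[a _ <-] Ja]|_ ->] /=; last first.
  by case: idI => _ I0 _ _; case: idJ.
have -> : a = 0; last exact: linear_map0 psiA_linear.
apply: amul_eq0l => x; apply: psiA_inj.
by rewrite psiAM Ja (linear_map0 psiA_linear).
Qed.

End Unique.

End Extension.

Theorem proposition3p4 (R : realType) (A B : cstarAlgType R)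
    (X : hilbertBimodType A) (Y : hilbertBimodType B)
    (psi : (X -> Y) * (A -> B)) :
  full_bimod X -> is_extension psi ->
  (exists! lambda : (Y -> mult_bimod X) * (B -> multiplier A),
     bimod_morphism lambda /\ bimod_comp lambda psi = iota_bimod X) /\
  (forall lambda : (Y -> mult_bimod X) * (B -> multiplier A),
     bimod_morphism lambda -> bimod_comp lambda psi = iota_bimod X ->
     injective_morphism lambda <-> is_essential_extension psi).
Proof.
move=> fullX ext; split; last by move=> mu; exact: injective_essential.
exists (lam fullX ext); split.
  by split; [exact: lam_morphism|exact: lam_comp].
by move=> mu [muM muC]; rewrite -(morphism_unique fullX ext muM muC).
Qed.
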